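(* Let $X$ be a real Banach space and let $f:X\to\mathbb{R}\cup\{\infty\}$ be a locally Lipschitz function with convex domain $\mathrm{dom}\, f$. Let $D\subseteq\mathrm{dom}\, f$ be self segment-dense in $\mathrm{dom}\, f$, and assume that $f$ is locally strictly quasiconvex on $D$. If the Clarke–Rockafellar subdifferential $\partial^{\uparrow}f$ is lower semicontinuous and has the property that $\langle z^*,x-y\rangle\neq0$ for all $x,y\in\mathrm{dom}\, f$ with $x\neq y$, all $z\in[x,y]\cap(\mathrm{dom}\, f\setminus D)$ and all $z^*\in\partial^{\uparrow}f(z)$, then $f$ is (globally) quasiconvex on $X$.
   Context: $X^*$ is the topological dual of $X$, $\langle x^*,x\rangle=x^*(x)$, and $[x,y]=\{x+t(y-x):t\in[0,1]\}$. $\mathrm{dom}\, f=\{x\in X: f(x)\in\mathbb{R}\}$. $f$ is locally Lipschitz if every $x\in\mathrm{dom}\, f$ has an open neighborhood in $X$ on which $f$ is finite and Lipschitz. For $x$ with $f(x)\in\mathbb{R}$ and $v\in X$, the Clarke–Rockafellar generalized derivative is $$f^{\uparrow}(x,v)=\sup_{\epsilon>0}\ \limsup_{(y,\alpha)\downarrow_f x,\ t\downarrow0}\ \inf_{u\in B(v,\epsilon)}\frac{f(y+tu)-\alpha}{t},$$ where $(y,\alpha)\downarrow_f x$ means $y\to x$, $\alpha\to f(x)$, $\alpha\ge f(y)$, and $B(v,\epsilon)$ is the open ball. (For locally Lipschitz $f$ this equals the Clarke directional derivative $\limsup_{y\to x,\,u\to v,\,t\downarrow0}\frac{f(y+tu)-f(y)}{t}$.)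 The Clarke–Rockafellar subdifferential is $\partial^{\uparrow}f(x)=\{x^*\in X^*:\langle x^*,v\rangle\le f^{\uparrow}(x,v)\ \forall v\in X\}$ (empty if $f(x)=\infty$). A set-valued $T:X\rightrightarrows X^*$ with domain $D(T)=\{x:T(x)\neq\emptyset\}$ is lower semicontinuous if for every $x\in D(T)$ and every (norm-)open $N\subseteq X^*$ with $T(x)\cap N\neq\emptyset$ there is a neighborhood $M$ of $x$ with $T(y)\cap N\ne\emptyset$ for all $y\in M\cap D(T)$. $P\subseteq S$ is dense in $S$ if $S\subseteq\mathrm{cl}(P)$. For $U\subseteq V\subseteq X$ with $V$ convex, $U$ is self segment-dense in $V$ if $U$ is dense in $V$ and for all $x,y\in U$ the set $[x,y]\cap U$ is dense in $[x,y]$. $f$ is locally strictly quasiconvex on $D$ if every $z\in D$ has an open neighborhood $U_z$ such that for all $x,y\in U_z\cap D$ with $x\neq y$ and all $t\in(0,1)$ with $x+t(y-x)\in D$ one has $f(x+t(y-x))<\max\{f(x),f(y)\}$. $f$ is quasiconvex if $f(x+t(y-x))\le\max\{f(x),f(y)\}$ for all $x,y\in\mathrm{dom}\, f$ and $t\in[0,1]$. *)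

(* Defs.v *)
From HB Require Import structures.
From mathcomp Require Import all_boot all_order all_algebra.
From mathcomp Require Import all_classical all_reals all_analysis.

Set Implicit Arguments.
Unset Strict Implicit.
Unset Printing Implicit Defensive.

Import Order.TTheory GRing.Theory Num.Theory.
Import numFieldNormedType.Exports.

Local Open Scope classical_set_scope.
Local Open Scope ring_scope.

Section Dual.
Context {R : realType} {X : normedModType R}.

Record dual := Dual {
  dual_fun :> {linear X -> R^o};
  dual_continuous : continuous dual_fun }.

Definition dual_norm (phi : X -> R) : R :=
  sup [set `|phi v| | v in [set v : X | `|v| <= 1]].

Definition dual_ball (phi : dual) (e : R) : set dual :=
  [set psi | dual_norm (fun v => phi v - psi v) < e].

Definition dual_open (N : set dual) : Prop :=
  forall phi, N phi -> exists2 e : R, 0 < e & dual_ball phi e `<=` N.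

Definition lower_semicontinuous_setvalued (T : X -> set dual) : Prop :=
  forall x, T x !=set0 -> forall N, dual_open N -> T x `&` N !=set0 ->
    \forall y \near x, T y !=set0 -> T y `&` N !=set0.

End Dual.

Arguments dual {R} X.

Section Density.
Context {R : realType} {X : normedModType R}.

Definition segment (x y : X) : set X :=
  [set x + t *: (y - x) | t in [set t : R | 0 <= t <= 1]].

Definition dense_in (P S : set X) : Prop := P `<=` S /\ S `<=` closure P.

Definition self_segment_dense (U V : set X) : Prop :=
  [/\ @convex_set R X V, dense_in U V &
      forall x y, U x -> U y -> dense_in (segment x y `&` U) (segment x y)].

End Density.

Section ExtendedRealFunctions.
Context {R : realType} {X : normedModType R}.
Implicit Types (f : X -> \bar R) (D : set X) (x v : X).

Definition dom f : set X := [set x | f x \is a fin_num].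

Definition locally_lipschitz f : Prop :=
  forall x, dom f x -> exists U : set X,
    [/\ open_nbhs x U, U `<=` dom f & [lipschitz (fine (f y) : R^o) | y in U]].

(* The filter of (y, a) -> (x, f x) with f y <= a; for x outside dom f it
   depends on the junk value fine (f x) = 0. *)
Definition epi_nbhs f x : set_system (X * R) :=
  within [set p : X * R | (f p.1 <= p.2%:E)%E] (nbhs (x, fine (f x))).

Definition clarke_rockafellar_quotient f v (e : R) (p : X * R * R) : \bar R :=
  let: (y, a, t) := p in
  ereal_inf [set ((f (y + t *: u)%R - a%:E) * (t^-1)%:E)%E | u in ball v e].

Definition clarke_rockafellar_derivative f x v : \bar R :=
  ereal_sup [set limf_esup (clarke_rockafellar_quotient f v e)
                           (filter_prod (epi_nbhs f x) (0 : R)^'+)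
            | e in [set e : R | 0 < e]].

Definition clarke_rockafellar_subdifferential f x : set (dual X) :=
  [set phi | dom f x /\
     forall v, ((phi v)%:E <= clarke_rockafellar_derivative f x v)%E].

Definition locally_strictly_quasiconvex_on D f : Prop :=
  forall z, D z -> exists2 U : set X, open_nbhs z U &
    forall x y, (U `&` D) x -> (U `&` D) y -> x != y ->
    forall t : R, 0 < t < 1 -> D (x + t *: (y - x)) ->
      (f (x + t *: (y - x))%R < Order.max (f x) (f y))%E.

Definition quasiconvex f : Prop :=
  forall x y, dom f x -> dom f y -> forall t : R, 0 <= t <= 1 ->
    (f (x + t *: (y - x))%R <= Order.max (f x) (f y))%E.

End ExtendedRealFunctions.

(* Main.v *)
Require Import Defs.
From HB Require Import structures.
From mathcomp Require Import all_boot all_order all_algebra.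
From mathcomp Require Import all_classical all_reals all_analysis.
From mathcomp Require Import lra.

Set Implicit Arguments.
Unset Strict Implicit.
Unset Printing Implicit Defensive.

Import Order.TTheory GRing.Theory Num.Theory.
Import numFieldNormedType.Exports.

Local Open Scope classical_set_scope.
Local Open Scope ring_scope.

(** By density of [D] and continuity of [f] it suffices to bound [f] on a
    segment with end points [x], [y] in [D].  If the bound fails, [f] attains
    its maximum over the segment at an interior point [z].  Strict
    quasiconvexity near [z] excludes [z] from [D].  Since [z] is a maximum along
    the segment, the Clarke derivative [p] of [f] at [z] is nonnegative at both
    [x - y] and [y - x]; as [p] is sublinear, the Hahn-Banach theorem gives a
    linear [phi] below [p] with [phi (x - y) = 0].  This [phi] belongs to the
    subdifferential of [f] at [z], which contradicts the hypothesis on points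
    outside [D]. *)

(** * Sublinear functionals and the linear functionals they dominate *)

Section HahnBanach.
Context {R : realType}.

Lemma le_infD (A B : set R) (c : R) : A !=set0 -> B !=set0 ->
  (forall a b, A a -> B b -> c <= a + b) -> c <= inf A + inf B.
Proof.
move=> A0 B0 cAB; rewrite -lerBlDr; apply: lb_le_inf => // a Aa.
rewrite lerBlDr -lerBlDl; apply: lb_le_inf => // b Bb.
by rewrite lerBlDl cAB.
Qed.

Context {V : lmodType R}.
Implicit Types (p q : V -> R) (v w x y : V).

Definition sublinear p : Prop :=
  (forall x y, p (x + y) <= p x + p y) /\
  (forall (c : R) x, 0 < c -> p (c *: x) <= c * p x).

Lemma sublinearZ p (c : R) x : sublinear p -> 0 < c -> p (c *: x) = c * p x.
Proof.
move=> [_ pZ] c0; apply/eqP; rewrite eq_le pZ//=.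
rewrite -ler_pdivlMl//; apply: le_trans (pZ _ _ _); last by rewrite invr_gt0.
by rewrite scalerA mulVf ?gt_eqF// scale1r.
Qed.

Lemma sublinear0 p : sublinear p -> p 0 = 0.
Proof.
move=> sp; have := sublinearZ 0 sp (ltr0n R 2); rewrite scaler0; lra.
Qed.

Lemma sublinearN p x : sublinear p -> - p (- x) <= p x.
Proof.
by move=> sp; have := sp.1 x (- x); rewrite subrr sublinear0//; lra.
Qed.

(** Take for [q x] the infimum over [t] of [p (x + t *: v) - t * a]. It is sublinear because the
    parameters [t] add and scale along with the vectors, and the hypothesis on [a] keeps it
    finite. *)
Lemma sublinear_shift p v (a : R) : sublinear p ->
  (forall t, t * a <= p (t *: v)) ->
  exists q, [/\ sublinear q, forall x, q x <= p x,
                q v <= a & q (- v) <= - a].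
Proof.
move=> sp pv.
pose S x := [set p (x + t *: v) - t * a | t in [set: R]].
have S0 x : S x !=set0 by exists (p (x + 0 *: v) - 0 * a), 0.
have S_lb x : has_lbound (S x).
  (* Combine [t * a <= p (t *: v)] with [p (t *: v) <= p (x + t *: v) + p (- x)]. *)
  exists (- p (- x)) => _ [t _ <-]; rewrite -lerBlDr opprK.
  have := sp.1 (x + t *: v) (- x); rewrite addrAC subrr add0r.
  by have := pv t; lra.
have le_S x t : inf (S x) <= p (x + t *: v) - t * a.
  by apply: ge_inf => //; exists t.
exists (fun x => inf (S x)); split.
- split=> [x y|c x c0].
    apply: le_infD => // _ _ [s _ <-] [t _ <-].
    apply: le_trans (le_S _ (s + t)) _.
    by rewrite scalerDl addrACA; have := sp.1 (x + s *: v) (y + t *: v); lra.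
  rewrite -ler_pdivrMl//; apply: lb_le_inf => // _ [t _ <-].
  rewrite ler_pdivrMl//; apply: le_trans (le_S _ (c * t)) _.
  by rewrite -scalerA -scalerDr sublinearZ// mulrBr mulrA.
- by move=> x; have := le_S x 0; rewrite scale0r addr0 mul0r subr0.
- by have := le_S v (-1); rewrite scaleN1r subrr sublinear0//; lra.
- by have := le_S (- v) 1; rewrite scale1r addNr sublinear0//; lra.
Qed.

(* A minimal sublinear functional is linear: lowering it by [sublinear_shift]
   at [v] with [a = q v] leaves it unchanged, which gives [q (- v) <= - q v]. *)
Lemma hahn_banach_dominated p : sublinear p ->
  exists phi : {linear V -> R^o}, forall x, phi x <= p x.
Proof.
move=> sp; pose T := {q | sublinear q /\ forall x, q x <= p x}.
(* The order is reversed, so a maximal element from Zorn's lemma is a minimal sublinear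
   functional. *)
pose le_T (q r : T) := `[< forall x, sval r x <= sval q x >].
have [||q r /asboolP qr /asboolP rq|A totA|[q [sq qp]] q_min] := @Zorn T le_T.
- by move=> q; exact/asboolP.
- move=> q r s /asboolP qr /asboolP rs; apply/asboolP => x.
  exact: le_trans (rs x) (qr x).
- apply: eq_sig_hprop; first by move=> *; exact: Prop_irrelevance.
  by apply/funext => x; apply/eqP; rewrite eq_le qr rq.
(* The empty chain is bounded by [p] itself, a nonempty one by its pointwise infimum, which is
   finite since each member at [x] is at least [- p (- x)]. *)
- have [[q0 Aq0]|A0] := pselect (A !=set0); last first.
    exists (exist _ p (conj sp (fun x => lexx (p x)))) => s As.
    by exfalso; apply: A0; exists s.
  pose S x := [set sval q x | q in A].
  have S0 x : S x !=set0 by exists (sval q0 x), q0.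
  have S_lb x : has_lbound (S x).
    exists (- p (- x)) => _ [q Aq <-]; have [sq qp] := svalP q.
    by apply: le_trans (sublinearN x sq); rewrite lerN2.
  have le_S (q : T) x : A q -> inf (S x) <= sval q x.
    by move=> Aq; apply: ge_inf => //; exists q.
  have sS : sublinear (fun x => inf (S x)).
    split=> [x y|c x c0].
      apply: le_infD => // _ _ [q Aq <-] [r Ar <-].
      (* In a chain one of [q], [r] lies below the other, and its subadditivity handles both
         points. *)
      have [/asboolP qr|/asboolP rq] := totA _ _ Aq Ar.
        apply: le_trans (le_S r _ Ar) _.
        by apply: le_trans ((svalP r).1.1 _ _) _; rewrite lerD2r.
      apply: le_trans (le_S q _ Aq) _.
      by apply: le_trans ((svalP q).1.1 _ _) _; rewrite lerD2l.
    rewrite -ler_pdivrMl//; apply: lb_le_inf => // _ [q Aq <-].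
    rewrite ler_pdivrMl//; apply: le_trans (le_S q _ Aq) _.
    by rewrite (sublinearZ _ (svalP q).1).
  have Sp x : inf (S x) <= p x.
    exact: le_trans (le_S q0 x Aq0) ((svalP q0).2 x).
  pose infA : T := exist _ (fun x => inf (S x)) (conj sS Sp).
  by exists infA => q Aq; apply/asboolP => x; exact: le_S.
have qN v : q (- v) = - q v.
  apply/eqP; rewrite eq_le; apply/andP; split; last first.
    by rewrite -[in leLHS](opprK v) sublinearN.
  have [t|r [sr rq _ rNv]] := @sublinear_shift q v (q v) sq.
    have [t0|t0|->] := ltgtP t 0; last by rewrite mul0r scale0r sublinear0.
    + rewrite -[t]opprK mulNr scaleNr.
      apply: le_trans (sublinearN _ sq).
      by rewrite opprK lerN2 sublinearZ// oppr_gt0.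
    + by rewrite sublinearZ.
  have rp x : r x <= p x := le_trans (rq x) (qp x).
  have /(congr1 sval)/= rE := q_min (exist _ r (conj sr rp) : T) (asboolT rq).
  by rewrite -rE in rNv *.
(* By oddness, subadditivity at [- x] and [- y] is superadditivity at [x] and [y]. *)
have qD x y : q (x + y) = q x + q y.
  apply/eqP; rewrite eq_le sq.1/=.
  by have := sq.1 (- x) (- y); rewrite -opprD !qN; lra.
have qZ (c : R) x : q (c *: x) = c * q x.
  have [c0|c0|->] := ltgtP c 0; last by rewrite mul0r scale0r sublinear0.
  - by rewrite -[c]opprK scaleNr qN sublinearZ ?oppr_gt0 // !mulNr.
  - exact: sublinearZ.
have lin_q : linear (q : V -> R^o) by move=> c x y; rewrite qD qZ.
pose L := GRing.isLinear.Build R V R^o *:%R q lin_q.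
pose phi : {linear V -> R^o} := HB.pack q L.
by exists phi => x; exact: qp.
Qed.
End HahnBanach.

(** * The Clarke directional derivative of a Lipschitz function *)

Section Clarke.
Context {R : realType} {X : normedModType R}.
Implicit Types (g : X -> R) (f : X -> \bar R) (z v w : X) (L : R).

Definition lipschitz_at g z L : Prop :=
  \forall y & y' \near z, `|g y - g y'| <= L * `|y - y'|.

(** These are the eventual upper bounds of the difference quotients as the base point tends to [z]
    and the step to [0] from the right. Their infimum is thus the limsup that defines Clarke's
    derivative, with the direction held fixed. *)
Definition clarke_slopes g z v : set R :=
  [set c | \forall q \near filter_prod (nbhs z) (0 : R)^'+,
             g (q.1 + q.2 *: v) - g q.1 <= c * q.2].

Definition clarke_derivative g z v : R := inf (clarke_slopes g z v).

Lemma lipschitz_at_continuous g z L :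
  lipschitz_at g z L -> g y @[y --> z] --> g z.
Proof.
move=> [[A B]/= [zA zB] ABg]; apply/cvgrPdist_lt => e e0.
have L0 : 0 < `|L| + 1 by rewrite ltr_wpDl.
have zy : \forall y \near z, `|z - y| < e / (`|L| + 1).
  by apply: (@cvgr_dist_lt _ _ _ _ _ id) => //; exact: divr_gt0.
apply: filterS2 zB zy => y By; rewrite ltr_pdivlMr// => zy.
apply: le_lt_trans (ABg (z, y) (conj (nbhs_singleton zA) By)) _ => /=.
apply: le_lt_trans zy; rewrite mulrC ler_wpM2l//.
by rewrite (le_trans (ler_norm L))// lerDl.
Qed.

Lemma near_point z (A : set X) : nbhs z A ->
  \forall q \near filter_prod (nbhs z) (0 : R)^'+, A q.1.
Proof. by move=> zA; exact: (cvg_fst zA). Qed.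

Lemma near_right z (B : set R) : (0 : R)^'+ B ->
  \forall q \near filter_prod (nbhs z) (0 : R)^'+, B q.2.
Proof. by move=> zB; exact: (cvg_snd zB). Qed.

Lemma cvg_right_scale (a : R) :
  0 < a -> t * a @[t --> (0 : R)^'+] --> (0 : R)^'+.
Proof.
move=> a0 A [e /= e0 eA]; exists (e / a); first exact: divr_gt0.
move=> t /=; rewrite sub0r normrN => te t0; apply: eA => /=.
  by rewrite sub0r normrN normrM (gtr0_norm a0) -ltr_pdivlMr.
exact: mulr_gt0.
Qed.

Lemma cvg_shift z v :
  q.1 + q.2 *: v @[q --> filter_prod (nbhs z) (0 : R)^'+] --> z.
Proof.
rewrite -[X in _ --> X]addr0 -[X in _ --> _ + X](scale0r v).
apply: cvgD; first exact: cvg_fst.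
apply: cvgZr_tmp; apply: cvg_trans (cvg_snd) _; exact: cvg_within.
Qed.

(** Convergence to [z] is uniform in [u], because [|u|] is at most [|v| + |e|] on the ball. *)
Lemma near_shift_ball z v (e : R) (A : set X) : nbhs z A ->
  \forall q \near filter_prod (nbhs z) (0 : R)^'+,
    forall u, ball v e u -> A (q.1 + q.2 *: u).
Proof.
move=> /nbhs_ballP[r /= r0 rA].
have M0 : 0 < `|v| + `|e| + 1 by rewrite ltr_wpDl// addr_ge0.
near=> q => u veu; apply: rA; rewrite -ball_normE/= opprD addrA.
have q20 : 0 < q.2 by near: q; exact: (near_right _ (nbhs_right_gt 0)).
have zq : ball z (r / 2) q.1.
  by near: q; apply: (near_point (nbhsx_ballx _ _ _)); rewrite divr_gt0.
have qr : q.2 < r / 2 / (`|v| + `|e| + 1).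
  by near: q; apply: (near_right _ (nbhs_right_lt _)); rewrite !divr_gt0.
apply: le_lt_trans (ler_normB _ _) _; rewrite normrZ gtr0_norm//.
rewrite [ltRHS]splitr; apply: ltrD; first by move: zq; rewrite -ball_normE.
apply: le_lt_trans (_ : q.2 * (`|v| + `|e| + 1) < _); last first.
  by rewrite -ltr_pdivlMr.
rewrite ler_pM2l//; move: veu; rewrite -ball_normE/= => veu.
have := ler_norm e; have := ler_normB v (v - u); rewrite subKr; lra.
Unshelve. all: by end_near.
Qed.

Lemma near_lipschitz_ball g z v L (e : R) : lipschitz_at g z L ->
  \forall q \near filter_prod (nbhs z) (0 : R)^'+, forall u w,
    ball v e u -> ball v e w ->
    `|g (q.1 + q.2 *: u) - g (q.1 + q.2 *: w)| <= L * (q.2 * `|u - w|).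
Proof.
move=> [[A B]/= [zA zB] ABg]; near=> q => u w vu vw.
have q20 : 0 < q.2 by near: q; exact: (near_right _ (nbhs_right_gt 0)).
have Aq : A (q.1 + q.2 *: u).
  by move: u vu {vw}; near: q; exact: near_shift_ball.
have Bq : B (q.1 + q.2 *: w).
  by move: w vw; near: q; exact: near_shift_ball.
have /= := ABg (_, _) (conj Aq Bq).
by rewrite opprD addrACA subrr add0r -scalerBr normrZ gtr0_norm.
Unshelve. all: by end_near.
Qed.

Section Lipschitz.
Variables (g : X -> R) (z : X) (L : R).
Hypothesis gL : lipschitz_at g z L.

Lemma near_lipschitz_shift v : \forall q \near filter_prod (nbhs z) (0 : R)^'+,
  `|g (q.1 + q.2 *: v) - g q.1| <= L * `|v| * q.2.
Proof.
(* The ball about [0] of radius [|v| + 1] contains both [v] and [0]. *)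
have := near_lipschitz_ball 0 (`|v| + 1) gL; apply: filterS => q qL.
have := qL v 0; rewrite scaler0 addr0 subr0 [q.2 * _]mulrC mulrA.
by apply; rewrite -ball_normE/= ?subrr ?sub0r ?normrN ?normr0 ?ltrDl// ltr_wpDl.
Qed.

(** With the lower bound below, this makes the [inf] in [clarke_derivative] a true infimum and not a
    default value. *)
Lemma clarke_slopes_neq0 v : clarke_slopes g z v !=set0.
Proof.
exists (L * `|v|); apply: filterS (near_lipschitz_shift v) => q.
exact/le_trans/ler_norm.
Qed.

Lemma clarke_slopes_ge v c : clarke_slopes g z v c -> - (L * `|v|) <= c.
Proof.
move=> cS.
have t0 : \forall q \near filter_prod (nbhs z) (0 : R)^'+, 0 < q.2.
  exact: (near_right _ (nbhs_right_gt 0)).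
have [q [[/= qc qL] q0]] :=
  filter_ex (filterI (filterI cS (near_lipschitz_shift v)) t0).
rewrite -(ler_pM2r q0) mulNr; apply: le_trans qc; move: qL.
by rewrite ler_norml => /andP[].
Qed.

Lemma clarke_slopes_lb v : has_lbound (clarke_slopes g z v).
Proof. by exists (- (L * `|v|)) => c /clarke_slopes_ge. Qed.

Lemma clarke_derivative_le v c :
  clarke_slopes g z v c -> clarke_derivative g z v <= c.
Proof. by move=> vc; apply: ge_inf => //; exact: clarke_slopes_lb. Qed.

Lemma clarke_derivative_le_norm v : clarke_derivative g z v <= L * `|v|.
Proof.
apply: clarke_derivative_le.
apply: filterS (near_lipschitz_shift v) => q; exact/le_trans/ler_norm.
Qed.

(** An increment along [v + w] splits at [y + t *: v], which is again a base point tending to [z];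
    this is where moving base points matter. Homogeneity is the change of step from [t] to
    [t * a]. *)
Lemma sublinear_clarke_derivative : sublinear (clarke_derivative g z).
Proof.
split=> [v w|a v a0].
  apply: le_infD; [exact: clarke_slopes_neq0..|move=> b c vb wc].
  apply: clarke_derivative_le.
  have cvg_vt : (q.1 + q.2 *: v, q.2) @[q --> filter_prod (nbhs z) (0 : R)^'+]
      --> (nbhs z, (0 : R)^'+).
    by apply: cvg_pair; [exact: cvg_shift|exact: cvg_snd].
  have wc' := cvg_vt _ wc.
  apply: filterS2 vb wc' => q /= qb; rewrite -addrA -scalerDr; lra.
rewrite -ler_pdivrMl//; apply: lb_le_inf => [|c vc].
  exact: clarke_slopes_neq0.
rewrite ler_pdivrMl//; apply: clarke_derivative_le.
have cvg_at : (q.1, q.2 * a) @[q --> filter_prod (nbhs z) (0 : R)^'+]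
    --> (nbhs z, (0 : R)^'+).
  apply: cvg_pair; first exact: cvg_fst.
  exact: (cvg_comp _ _ cvg_snd (cvg_right_scale a0)).
have : \forall q \near filter_prod (nbhs z) (0 : R)^'+,
    g (q.1 + (q.2 * a) *: v) - g q.1 <= c * (q.2 * a) := cvg_at _ vc.
by apply: filterS => q; rewrite scalerA [a * c]mulrC -mulrA [a * q.2]mulrC.
Qed.

(** Use the base points [z - t *: v]: a step [t] along [v] leads to [z], where [g] is at least as
    large. *)
Lemma clarke_derivative_ge0 v :
  (\forall t \near (0 : R)^'+, g (z - t *: v) <= g z) ->
  0 <= clarke_derivative g z v.
Proof.
move=> gmax; apply: lb_le_inf => [|c vc]; first exact: clarke_slopes_neq0.
have cvg_t : (z - t *: v, t) @[t --> (0 : R)^'+]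
    --> (nbhs z, (0 : R)^'+).
  apply: cvg_pair; last exact: cvg_id.
  suff : z - t *: v @[t --> (0 : R)^'+] --> z - 0 *: v.
    by rewrite scale0r subr0.
  by apply: cvgB; [exact: cvg_cst|apply: cvgZr_tmp; exact: cvg_within].
have vc' : \forall t \near (0 : R)^'+,
    g (z - t *: v + t *: v) - g (z - t *: v) <= c * t := cvg_t _ vc.
have [t [/= [tc t0] tg]] :=
  filter_ex (filterI (filterI vc' (@nbhs_right_gt _ 0)) gmax).
rewrite -(ler_pM2r t0) mul0r; apply: le_trans tc.
by rewrite subrK subr_ge0.
Qed.

End Lipschitz.

(** This places linear functionals below the Clarke derivative in the subdifferential. Look only at
    heights equal to [f y]; replacing a [u] of the inner infimum by [v] then costs at most
    [(|L| + 1) * e] per unit step. *)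
Lemma clarke_derivative_le_clarke_rockafellar f z v L :
  lipschitz_at (fine \o f) z L -> (\forall y \near z, dom f y) ->
  ((clarke_derivative (fine \o f) z v)%:E <=
   clarke_rockafellar_derivative f z v)%E.
Proof.
set g := fine \o f => gL zf; apply/lee_addgt0Pr => n n0.
(* Chosen so that [(|L| + 1) * e = n / 2]. *)
pose e := n / 2 / (`|L| + 1).
have L0 : 0 < `|L| + 1 by rewrite ltr_wpDl.
have e0 : 0 < e by rewrite !divr_gt0.
rewrite -leeBlDr// -EFinB; set a := _ - n.
apply: le_ereal_sup_tmp; exists (limf_esup (clarke_rockafellar_quotient f v e)
                           (filter_prod (epi_nbhs f z) (0 : R)^'+)).
  by exists e.
apply: le_ereal_inf_tmp => _ [V FV <-]; rewrite leNgt; apply/negP => supV.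
(* This number is [n / 2] below the infimum of the slopes. *)
suff : clarke_slopes g z v (a + n / 2).
  by move=> /(clarke_derivative_le gL); rewrite /a; lra.
(* The pairs [(y, g y)] are admissible: near [z] they lie on the graph of [f], and [g] is continuous
   at [z]. *)
have cvg_epi : (q.1, g q.1, q.2) @[q --> filter_prod (nbhs z) (0 : R)^'+]
    --> (epi_nbhs f z, (0 : R)^'+).
  apply: cvg_pair; last exact: cvg_snd.
  suff epi_g : (y, g y) @[y --> z] --> epi_nbhs f z.
    exact: (cvg_comp _ _ cvg_fst epi_g).
  move=> A zA; have zzA : \forall y \near z, (f y <= (g y)%:E)%E -> A (y, g y).
    exact: (cvg_pair cvg_id (lipschitz_at_continuous gL) zA).
  suff : \forall y \near z, A (y, g y) by [].
  by apply: filterS2 zf zzA => y fy; apply; rewrite fineK.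
near=> q.
have q0 : 0 < q.2 by near: q; exact: (near_right _ (nbhs_right_gt 0)).
have Vq : V (q.1, g q.1, q.2) by near: q; exact: cvg_epi.
have : (clarke_rockafellar_quotient f v e (q.1, g q.1, q.2) < a%:E)%E.
  by apply: le_lt_trans supV; apply: ereal_sup_ubound; exists (q.1, g q.1, q.2).
move=> /ereal_inf_lt[_ [u vu <-]].
have fu : dom f (q.1 + q.2 *: u).
  by move: u vu; near: q; exact: near_shift_ball.
rewrite -(fineK fu) -EFinB -EFinM lte_fin ltr_pdivrMr// => ua.
have : `|g (q.1 + q.2 *: v) - g (q.1 + q.2 *: u)| <= L * (q.2 * `|v - u|).
  suff qL : forall u w, ball v e u -> ball v e w ->
      `|g (q.1 + q.2 *: u) - g (q.1 + q.2 *: w)| <= L * (q.2 * `|u - w|).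
    by apply: qL => //; exact: ballxx.
  by near: q; exact: near_lipschitz_ball.
rewrite ler_norml => /andP[_].
have : L * (q.2 * `|v - u|) <= n / 2 * q.2.
  rewrite mulrCA mulrC ler_pM2r//.
  apply: le_trans (_ : (`|L| + 1) * e <= _).
    apply: (@le_trans _ _ ((`|L| + 1) * `|v - u|)).
      by rewrite ler_wpM2r// (le_trans (ler_norm L))// lerDl.
    by rewrite ler_pM2l// ltW//; move: vu; rewrite -ball_normE.
  by rewrite mulrC divfK// gt_eqF.
move: ua; rewrite /a /g /= !mulrDl; lra.
Unshelve. all: by end_near.
Qed.

End Clarke.

(** * Maxima along a segment: subgradients there and exclusion from [D] *)

Section QuasiconvexityOnDenseSet.
Context {R : realType} {X : normedModType R}.
Implicit Types (f : X -> \bar R) (D : set X) (x y z v : X).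

Lemma linear_le_norm_continuous (phi : {linear X -> R^o}) (L : R) :
  (forall v, phi v <= L * `|v|) -> continuous phi.
Proof.
move=> phiL; apply/linear_bounded_continuous/linear_boundedP.
near=> M => v; apply: (@le_trans _ _ (L * `|v|)); last first.
  by rewrite ler_wpM2r//; near: M; exact: nbhs_pinfty_ge.
by rewrite ler_norml phiL andbT lerNl -linearN (le_trans (phiL _))// normrN.
Unshelve. all: by end_near.
Qed.

Lemma locally_lipschitz_at f z : locally_lipschitz f -> dom f z ->
  (\forall y \near z, dom f y) /\ exists L, lipschitz_at (fine \o f) z L.
Proof.
move=> fL /fL[U [zU Uf [M [_ ML]]]].
have nU : nbhs z U by exact: open_nbhs_nbhs.
split; first exact: filterS nU.
(* The Lipschitz bound is given for every constant strictly above [M]. *)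
exists (M + 1); exists (U, U) => // -[a b] [/= Ua Ub].
have M1 : M < M + 1 by rewrite ltrDl.
exact: (ML _ M1 (a, b) (conj Ua Ub)).
Qed.

(** A Fermat rule for a maximum along a line. Continuity of the functional comes from the bound of
    the Clarke derivative by [L * |w|]. *)
Lemma clarke_rockafellar_subdifferential_ker f z v :
  locally_lipschitz f -> dom f z ->
  (\forall t \near (0 : R)^'+, fine (f (z + t *: v)) <= fine (f z)) ->
  (\forall t \near (0 : R)^'+, fine (f (z - t *: v)) <= fine (f z)) ->
  exists2 phi, clarke_rockafellar_subdifferential f z phi & phi v = 0.
Proof.
move=> fL zf maxp maxn; have [nf [L gL]] := locally_lipschitz_at fL zf.
set p := clarke_derivative (fine \o f) z.
have sp : sublinear p by exact: sublinear_clarke_derivative gL.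
have pv : 0 <= p v by exact: clarke_derivative_ge0 gL _ maxn.
have pNv : 0 <= p (- v).
  apply: (clarke_derivative_ge0 gL); move: maxp.
  by apply: filterS => t; rewrite scalerN opprK.
(* Prescribing the value [0] at [v] is allowed as [p] is nonnegative at [v] and [- v]. Any linear
   functional below [q] is then nonpositive at both, hence zero at [v]. *)
have [t|q [sq qp qv qNv]] := @sublinear_shift _ _ p v 0 sp.
  rewrite mulr0; have [t0|t0|->] := ltgtP t 0.
  - rewrite -[t]opprK scaleNr -scalerN sublinearZ ?oppr_gt0//.
    by rewrite mulr_ge0// oppr_ge0 ltW.
  - by rewrite sublinearZ// mulr_ge0// ltW.
  - by rewrite scale0r sublinear0.
have [phi phi_q] := hahn_banach_dominated sq.
have phi_p w : phi w <= p w := le_trans (phi_q w) (qp w).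
have phi_cont : continuous phi.
  apply: (@linear_le_norm_continuous _ L) => w.
  by apply: le_trans (phi_p w) _; exact: clarke_derivative_le_norm.
exists (Dual phi_cont).
  split=> // w.
  apply: le_trans (clarke_derivative_le_clarke_rockafellar w gL nf).
  by rewrite lee_fin.
apply/eqP; rewrite eq_le /= (le_trans (phi_q v))//=.
by rewrite -oppr_le0 -[leRHS]oppr0 -linearN (le_trans (phi_q _)).
Qed.

(** The ball about the midpoint of the subsegment, with radius half its length, meets the segment
    exactly in parameters between [a] and [b]. *)
Lemma segment_dense_param D x y (a b : R) :
  x != y -> 0 <= a -> a < b -> b <= 1 ->
  dense_in (segment x y `&` D) (segment x y) ->
  exists2 s, a < s < b & D (x + s *: (y - x)).
Proof.
move=> xy a0 ab b1 [_ xyD].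
pose m := (a + b) / 2; pose d := (b - a) / 2.
have yx0 : 0 < `|y - x| by rewrite normr_gt0 subr_eq0 eq_sym.
have d0 : 0 < d by rewrite divr_gt0// subr_gt0.
have m01 : 0 <= m <= 1 by rewrite /m; apply/andP; split; lra.
have xym : segment x y (x + m *: (y - x)) by exists m.
have [_ [[[s _ <-] Ds]]] := xyD _ xym _ (nbhsx_ballx _ _ (mulr_gt0 d0 yx0)).
rewrite -ball_normE/= opprD addrACA subrr add0r -scalerBl normrZ ltr_pM2r//.
rewrite ltr_norml => /andP[sm1 sm2]; exists s => //.
by move: sm1 sm2; rewrite /m /d => *; apply/andP; split; lra.
Qed.

Lemma cvg_line x v (s : R) : x + r *: v @[r --> s] --> x + s *: v.
Proof. by apply: cvgD; [exact: cvg_cst|apply: cvgZr_tmp; exact: cvg_id]. Qed.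

(** Otherwise density gives points of [D] on both sides of the maximum and close to it, and strict
    quasiconvexity puts the maximum strictly below one of their values. *)
Lemma strictly_quasiconvex_argmax_notin f D x y (c : R) :
  locally_strictly_quasiconvex_on D f -> x != y -> 0 < c < 1 ->
  dense_in (segment x y `&` D) (segment x y) ->
  (forall s, 0 <= s <= 1 ->
    (f (x + s *: (y - x))%R <= f (x + c *: (y - x))%R)%E) ->
  ~ D (x + c *: (y - x)).
Proof.
move=> fD xy /andP[c0 c1] xyD hmax Dz; have [U [oU Uz] Uqc] := fD _ Dz.
have /nbhs_ballP[e /= e0 eU] : nbhs c [set s | U (x + s *: (y - x))].
  by apply: cvg_line; exact: open_nbhs_nbhs.
(* Truncation at [0] and [1] keeps the parameters on the segment while they stay within [e] of
   [c]. *)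
have ac : Num.max 0 (c - e) < c by rewrite gt_max c0/= ltrBlDr ltrDl.
have a0 : 0 <= Num.max 0 (c - e) by rewrite le_max lexx.
have cb : c < Num.min 1 (c + e) by rewrite lt_min c1/= ltrDl.
have b1 : Num.min 1 (c + e) <= 1 by rewrite ge_min lexx.
have [s] := segment_dense_param xy a0 ac (ltW c1) xyD.
rewrite gt_max => /andP[/andP[s0 es] sc] Ds.
have [t] := segment_dense_param xy (ltW c0) cb b1 xyD.
rewrite lt_min => /andP[ct /andP[t1 te]] Dt.
have Us : U (x + s *: (y - x)).
  by apply: eU; rewrite -ball_normE/= ltr_norml; apply/andP; split; lra.
have Ut : U (x + t *: (y - x)).
  by apply: eU; rewrite -ball_normE/= ltr_norml; apply/andP; split; lra.
(* The position of parameter [c] relative to [s] and [t]. *)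
pose r := (c - s) / (t - s).
have st : 0 < t - s by rewrite subr_gt0 (lt_trans sc).
have dE : x + t *: (y - x) - (x + s *: (y - x)) = (t - s) *: (y - x).
  by rewrite opprD addrACA subrr add0r -scalerBl.
have zE : x + s *: (y - x) + r *: (x + t *: (y - x) - (x + s *: (y - x))) =
          x + c *: (y - x).
  rewrite dE scalerA /r divfK ?gt_eqF// -addrA -scalerDl.
  by rewrite addrCA subrr addr0.
have st_neq : x + s *: (y - x) != x + t *: (y - x).
  rewrite eq_sym -subr_eq0 dE scaler_eq0 negb_or gt_eqF//=.
  by rewrite subr_eq0 eq_sym.
have r01 : 0 < r < 1.
  apply/andP; split; first by rewrite divr_gt0// subr_gt0.
  by rewrite ltr_pdivrMr// mul1r ltrD2r.
have := Uqc _ _ (conj Us Ds) (conj Ut Dt) st_neq _ r01.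
rewrite zE => /(_ Dz); apply/negP; rewrite -leNgt ge_max.
by apply/andP; split; apply: hmax; apply/andP; split; lra.
Qed.

Lemma convex_set_segment (A : set X) x y (t : R) : @convex_set R X A ->
  A x -> A y -> 0 <= t <= 1 -> A (x + t *: (y - x)).
Proof.
move=> cA Ax Ay /andP[t0 t1].
(* [conv] puts the weight [t] on its first point, hence the swap. *)
have := cA y x (Itv01 t0 t1) (mem_set Ay) (mem_set Ax).
suff -> : conv (Itv01 t0 t1) (y : convex_lmodType X) x = x + t *: (y - x).
  by move=> /set_mem.
by rewrite /conv/= /unstable.onem scalerBl scale1r scalerBr addrCA.
Qed.

End QuasiconvexityOnDenseSet.

(** * The bound for end points in [D] and its extension to [dom f] *)

Theorem theorem4p1 (R : realType) (X : completeNormedModType R)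
    (f : X -> \bar R) (D : set X)
    (f_gt_ninfty : forall x, (-oo < f x)%E)
    (f_locally_lipschitz : locally_lipschitz f)
    (dom_f_convex : @convex_set R X (dom f))
    (D_self_segment_dense : self_segment_dense D (dom f))
    (f_lsqc : locally_strictly_quasiconvex_on D f)
    (subdiff_lsc :
      lower_semicontinuous_setvalued (clarke_rockafellar_subdifferential f))
    (subdiff_neq0 : forall x y : X, dom f x -> dom f y -> x != y ->
      forall z : X, (segment x y `&` (dom f `\` D)) z ->
      forall zs : dual X, clarke_rockafellar_subdifferential f z zs ->
        zs (x - y) != 0) :
  quasiconvex f.
Proof.
have [_ [Ddom domD] D_seg] := D_self_segment_dense.
set g := fine \o f.
have fE z : dom f z -> f z = (g z)%:E by move=> ?; rewrite /g /= fineK.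
have g_cont z : dom f z -> g w @[w --> z] --> g z.
  move=> /(locally_lipschitz_at f_locally_lipschitz)[_ [L gL]].
  exact: lipschitz_at_continuous gL.
have seg_dom x y (t : R) : dom f x -> dom f y -> 0 <= t <= 1 ->
    dom f (x + t *: (y - x)).
  exact: convex_set_segment.
have qcD x y (t : R) : D x -> D y -> 0 <= t <= 1 ->
    g (x + t *: (y - x)) <= Num.max (g x) (g y).
  move=> Dx Dy t01; rewrite leNgt; apply/negP => max_lt.
  have [xf yf] := (Ddom _ Dx, Ddom _ Dy).
  pose h (s : R) := g (x + s *: (y - x)).
  have h0 : h 0 = g x by rewrite /h scale0r addr0.
  have h1 : h 1 = g y by rewrite /h scale1r addrC subrK.
  have h_cont : {within `[0, 1], continuous h}.
    apply: continuous_in_subspaceT => s; rewrite inE/= in_itv/= => s01.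
    exact: (cvg_comp _ _ (@cvg_line _ _ _ _ _)
                      (g_cont _ (seg_dom _ _ _ xf yf s01))).
  have [c] := EVT_max ler01 h_cont; rewrite in_itv/= => c01 hmax.
  have {}hmax s : 0 <= s <= 1 -> h s <= h c.
    by move=> s01; apply: hmax; rewrite in_itv.
  (* The maximum exceeds both end values, which forces [0 < c < 1] and [x != y]. *)
  have hxy : Num.max (h 0) (h 1) < h c.
    by rewrite h0 h1; apply: lt_le_trans max_lt _; exact: hmax.
  have /andP[c0 c1] : 0 < c < 1.
    move: hxy; rewrite gt_max => /andP[hx hy].
    rewrite !lt_neqAle; case/andP: c01 => -> ->; rewrite !andbT.
    apply/andP; split; apply/eqP => cE.
      by move: hx; rewrite -cE ltxx.
    by move: hy; rewrite cE ltxx.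
  have xy : x != y.
    apply/eqP => xyE; move: hxy; rewrite /h xyE subrr !scaler0 gt_max ltxx//.
  set z := x + c *: (y - x).
  have zf : dom f z by exact: seg_dom.
  have nDz : ~ D z.
    apply: (strictly_quasiconvex_argmax_notin f_lsqc) => //.
    - by rewrite c0.
    - exact: D_seg.
    - move=> s s01; have sf := seg_dom _ _ _ xf yf s01.
      by rewrite (fE _ sf) (fE _ zf) lee_fin hmax.
  have [zs zs_sub zs0] : exists2 zs,
      clarke_rockafellar_subdifferential f z zs & zs (x - y) = 0.
    (* The two directions move the parameter to [c - s] and [c + s], still in the unit interval for
       small [s]. *)
    apply: clarke_rockafellar_subdifferential_ker => //.
    - near=> s; have -> : z + s *: (x - y) = x + (c - s) *: (y - x).
        by rewrite -opprB scalerN scalerBl addrA.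
      apply: hmax; have ? : 0 < s by [].
      have ? : s <= c by near: s; exact: nbhs_right_le.
      by apply/andP; split; lra.
    - near=> s; have -> : z - s *: (x - y) = x + (c + s) *: (y - x).
        by rewrite -[x - y]opprB scalerN opprK scalerDl addrA.
      apply: hmax; have ? : 0 < s by [].
      have ? : s <= 1 - c by near: s; apply: nbhs_right_le; rewrite subr_gt0.
      by apply/andP; split; lra.
  have : zs (x - y) != 0.
    by apply: subdiff_neq0 zs_sub => //; split => //; exists c.
  by rewrite zs0 eqxx.
move=> x y xf yf t t01.
rewrite !fE//; last exact: seg_dom.
rewrite -EFin_max lee_fin leNgt; apply/negP => max_lt.
(* The level [m] separates the two sides by open conditions, so they survive moving [x] and [y] to
   nearby points of [D] with [t] fixed. *)
have [m /andP[max_m m_lt]] :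
    exists m, Num.max (g x) (g y) < m < g (x + t *: (y - x)).
  exists ((Num.max (g x) (g y) + g (x + t *: (y - x))) / 2).
  by rewrite midf_lt//= midf_lt.
move: max_m; rewrite gt_max => /andP[xm ym].
have cvg_seg : p.1 + t *: (p.2 - p.1) @[p --> (x, y)] --> x + t *: (y - x).
  apply: cvgD; first exact: cvg_fst.
  by apply: cvgZl_tmp; apply: cvgB; [exact: cvg_snd|exact: cvg_fst].
have cvg_g := cvg_comp _ _ cvg_seg (g_cont _ (seg_dom _ _ _ xf yf t01)).
have [[A B]/= [xA yB] AB] : \forall p \near (x, y),
    m < g (p.1 + t *: (p.2 - p.1)) by exact: (cvgr_gt _ cvg_g _ m_lt).
have xA' : nbhs x (A `&` [set w | g w < m]).
  by apply: filterI => //; exact: (cvgr_lt _ (g_cont _ xf) _ xm).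
have yB' : nbhs y (B `&` [set w | g w < m]).
  by apply: filterI => //; exact: (cvgr_lt _ (g_cont _ yf) _ ym).
have [x' [Dx' [Ax' x'm]]] := domD _ xf _ xA'.
have [y' [Dy' [By' y'm]]] := domD _ yf _ yB'.
have := qcD _ _ _ Dx' Dy' t01; apply/negP; rewrite -ltNge.
apply: lt_trans (AB (x', y') (conj Ax' By')).
by rewrite gt_max x'm.
Unshelve. all: by end_near.
Qed.
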